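(* Suppose that the descriptor system $Ex(t+1)=Ax(t)+Bu(t)$, $y(t)=Cx(t)+Du(t)$ (with $A,E\in\mathbb R^{n\times n}$, $B\in\mathbb R^{n\times m}$, $C\in\mathbb R^{p\times n}$, $D\in\mathbb R^{p\times m}$) is regular and R-controllable, and let $q$ and $s$ be its quasi-Weierstraß dimension and nilpotency index. Let $T,L\in\mathbb N$ satisfy $(m+1)(L+q+s)-1\le T$, and let $(\bar u,\bar y)\in\mathfrak B_{\mathrm m}[0,T-1]$ be such that $\bar u$ is persistently exciting of order $L+q+s-1$. Then, for functions $u:[0:L-1]\to\mathbb R^m$ and $y:[0:L-1]\to\mathbb R^p$, one has $(u,y)\in\mathfrak B_{\mathrm m}[0,L-1]$ if and only if there is $\alpha\in\mathbb R^{T-s-L+2}$ such that $$\begin{bmatrix} H_L(\bar{\mathbf u}_{[0,T-s]})\\ H_L(\bar{\mathbf y}_{[0,T-s]})\end{bmatrix}\alpha=\begin{bmatrix}\mathbf u_{[0,L-1]}\\ \mathbf y_{[0,L-1]}\end{bmatrix}.$$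
   Context: Notation: $\mathbb N_0=\{0,1,2,\dots\}$, $\mathbb N=\{1,2,\dots\}$, and $[a:b]=[a,b]\cap\mathbb N_0$. System: consider the discrete-time linear descriptor system $Ex(t+1)=Ax(t)+Bu(t)$, $y(t)=Cx(t)+Du(t)$, where $E$ may be singular. It is regular if $\det(\lambda E-A)\ne 0$ for some $\lambda\in\mathbb C$. It is R-controllable if $\operatorname{rk}[\lambda E-A\;\; B]=n$ for all $\lambda\in\mathbb C$. Quasi-Weierstraß form: by regularity there are invertible $S,P\in\mathbb R^{n\times n}$ with $SEP=\begin{bmatrix}I_q&0\\0&N\end{bmatrix}$ and $SAP=\begin{bmatrix}A_1&0\\0&I_r\end{bmatrix}$, where $A_1\in\mathbb R^{q\times q}$, $q+r=n$, and $N\in\mathbb R^{r\times r}$ is nilpotent with nilpotency index $s$ (the smallest $s\ge 1$ with $N^s=0$; $s=1$ if $r=0$). The numbers $q,r,s$ do not depend on the choice of $S,P$. Behaviors: the full behavior $\mathfrak B_{\mathrm f}$ is the set of all $(x,u,y):\mathbb N_0\to\mathbb R^n\times\mathbb R^m\times\mathbb R^p$ satisfying the two system equations for all $t\in\mathbb N_0$. The manifest behavior $\mathfrak B_{\mathrm m}$ is the set of all $(u,y):\mathbb N_0\to\mathbb R^m\times\mathbb R^p$ for which there exists $x:\mathbb N_0\to\mathbb R^n$ with $(x,u,y)\in\mathfrak B_{\mathrm f}$. For $t\le t'$ in $\mathbb N_0$, $\mathfrak B_{\mathrm m}[t,t']=\{b|_{[t:t']} : b\in\mathfrak B_{\mathrm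 m}\}$ (restrictions of infinite trajectories). Vectorization and Hankel matrices: for a function $f$ with values in $\mathbb R^k$ defined (at least) on $[a:b]$, $\mathbf f_{[a,b]}=[f(a)^\top\ \cdots\ f(b)^\top]^\top\in\mathbb R^{k(b-a+1)}$. For $L\in\mathbb N$, $L\le b-a+1$, the Hankel matrix $H_L(\mathbf f_{[a,b]})\in\mathbb R^{kL\times(b-a-L+2)}$ is the matrix whose $j$-th column ($j=0,\dots,b-a-L+1$) is $\mathbf f_{[a+j,a+j+L-1]}$. Persistency of excitation: $u:[0:T-1]\to\mathbb R^m$ is persistently exciting of order $K$ if $H_K(\mathbf u_{[0,T-1]})$ has rank $mK$. *)

(* Defs.v *)
From mathcomp Require Import all_boot all_order all_algebra.
From mathcomp Require Import complex.
From mathcomp Require Import classical_sets reals.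

Set Implicit Arguments.
Unset Strict Implicit.
Unset Printing Implicit Defensive.

Import GRing.Theory.
Local Open Scope ring_scope.
Local Open Scope classical_set_scope.

Section Descriptor.
Variable R : realType.

Definition to_C m n (M : 'M[R]_(m, n)) : 'M[R[i]]_(m, n) :=
  map_mx (real_complex R) M.

Definition regular n (E A : 'M[R]_n) : Prop :=
  exists z : R[i], \det (z *: to_C E - to_C A) != 0.

Definition R_controllable n m (E A : 'M[R]_n) (B : 'M[R]_(n, m)) : Prop :=
  forall z : R[i], \rank (row_mx (z *: to_C E - to_C A) (to_C B)) = n.

Definition nilpotency_index r (N : 'M[R]_r) (s : nat) : Prop :=
  [/\ (0 < s)%N, N ^+ s = 0
    & forall k : nat, (0 < k)%N -> N ^+ k = 0 -> (s <= k)%N].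

(* q and s are the dimension and the nilpotency index of some
   quasi-Weierstrass form of (E, A); for regular pairs such a form exists,
   and q and s do not depend on its choice. *)
Definition quasi_weierstrass n (E A : 'M[R]_n) (q s : nat) : Prop :=
  exists (r : nat) (qr_n : (q + r)%N = n) (S P : 'M[R]_n)
         (A1 : 'M[R]_q) (N : 'M[R]_r),
    [/\ S \in unitmx /\ P \in unitmx,
        S *m E *m P = castmx (qr_n, qr_n) (block_mx 1%:M 0 0 N),
        S *m A *m P = castmx (qr_n, qr_n) (block_mx A1 0 0 1%:M)
      & nilpotency_index N s].

Definition signal (k : nat) : Type := nat -> 'cV[R]_k.

Definition full_behavior n m p (E A : 'M[R]_n) (B : 'M[R]_(n, m))
    (C : 'M[R]_(p, n)) (D : 'M[R]_(p, m)) :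
    set (signal n * signal m * signal p) :=
  [set w | let: (x, u, y) := w in
    forall t : nat, E *m x t.+1 = A *m x t + B *m u t
                 /\ y t = C *m x t + D *m u t].

Definition manifest_behavior n m p (E A : 'M[R]_n) (B : 'M[R]_(n, m))
    (C : 'M[R]_(p, n)) (D : 'M[R]_(p, m)) : set (signal m * signal p) :=
  [set w | exists x : signal n, full_behavior E A B C D (x, w.1, w.2)].

(* A function on [t : t'] is represented by any signal extending it: only the
   values on [t : t'] matter, and (u, y) belongs to the restricted behavior
   iff it coincides there with an infinite manifest trajectory. *)
Definition restricted_behavior n m p (E A : 'M[R]_n) (B : 'M[R]_(n, m))
    (C : 'M[R]_(p, n)) (D : 'M[R]_(p, m)) (t t' : nat) :
    set (signal m * signal p) :=
  [set w | exists2 b, manifest_behavior E A B C D b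
    & forall k : nat, (t <= k <= t')%N -> w.1 k = b.1 k /\ w.2 k = b.2 k].

(* The stacked vector f_[a, a + l - 1], indexed by its first instant a and its
   length l; it has \sum_(i < l) k = k * l rows. *)
Definition stack k (f : signal k) (a l : nat) : 'cV[R]_(\sum_(i < l) k) :=
  \mxcol_(i < l) f (a + i)%N.

(* The Hankel matrix H_L (f_[a, a + l - 1]) of l samples of f, meaningful for
   0 < L <= l; column j is f_[a + j, a + j + L - 1], and there are l - L + 1
   columns. *)
Definition hankel (L : nat) k (f : signal k) (a l : nat) :
    'M[R]_(\sum_(i < L) k, l.+1 - L) :=
  \matrix_(i, j) stack f (a + j) L i 0.

(* The samples are u 0, ..., u (T - 1), and K is the order of excitation. *)
Definition persistently_exciting m (u : signal m) (T K : nat) : Prop :=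
  \rank (hankel K u 0 T) = (m * K)%N.

End Descriptor.

(* Main.v *)
Require Import Defs.
From mathcomp Require Import all_boot all_order all_algebra.
From mathcomp Require Import complex.
From mathcomp Require Import classical_sets reals.
From mathcomp Require Import zify.

Set Implicit Arguments.
Unset Strict Implicit.
Unset Printing Implicit Defensive.

Import GRing.Theory.
Local Open Scope ring_scope.

(** The behavior is linear and invariant under time shifts, so every linear
combination of shifts of the data trajectory is again a trajectory, and its
window [0, L - 1] is what the Hankel matrices compute: this is the direction
from alpha to the behavior.

Conversely, in quasi-Weierstrass coordinates the state splits into a slow part
x1(t+1) = A1 x1(t) + B1 u(t) and a fast part x2(t) = N x2(t+1) - B2 u(t).
Unrolling the latter s times gives
x2(t) = - sum_(i < s) N^i B2 u(t + i), so that a trajectory on [0, L - 1] is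
determined by x1(0) and by the inputs u(0), ..., u(L + s - 2)
([full_behavior_eq0], for differences of trajectories). It therefore suffices
to realize any such pair as a combination of the shifts of the data, which is
the fundamental lemma of Willems for the controllable slow subsystem
([fundamental_lemma]), with K = L + s - 1 inputs.

By duality ([combine_span]) the fundamental lemma says that a relation
    xi x1(t) + eta_0 u(t) + ... + eta_(K-1) u(t+K-1) = 0
valid throughout the data must be trivial. Write eta(z) = sum_i eta_i z^i and
let z act as the forward shift. For every number a, the relation at t + 1 minus
a times the relation at t is again a relation: (xi, eta) has become
(xi (A1 - a), xi B1 + (z - a) eta). Over the complex numbers, take for a the
eigenvalues of A1 in turn. After q steps the state part is
xi char_poly(A1) = 0 by Cayley-Hamilton, what remains is a relation on K + q
consecutive inputs, and persistency of excitation makes it trivial. Each step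
can be undone ([shifted_eq0]): if (xi (A1 - a), xi B1 + (z - a) eta) = 0 then
eta = 0 for reasons of degree, hence xi B1 = 0 and xi A1 = a xi, and the
rank condition defining controllability at a gives xi = 0. *)

(** * Relations between the state and the inputs of a controllable system *)

(** Persistency of excitation of order K, seen from the left kernel of a Hankel
matrix with N columns. A row polynomial of size at most K is encoded as the
sequence of its coefficients, which vanishes from K on. *)
Definition exciting (F : fieldType) m (u : nat -> 'cV[F]_m) (K N : nat) :=
  forall eta : nat -> 'rV[F]_m, (forall i, (K <= i)%N -> eta i = 0) ->
    (forall t, (t < N)%N -> \sum_(i < K) eta i *m u (t + i)%N = 0) ->
    forall i, eta i = 0.

(** The Popov-Belevitch-Hautus criterion: no left eigenvector of A is killed by
B. Equivalently, row_mx (a - A) B has full row rank for every a. *)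
Definition hautus (F : fieldType) q m (A : 'M[F]_q) (B : 'M[F]_(q, m)) :=
  forall (a : F) (xi : 'rV[F]_q), xi *m A = a *: xi -> xi *m B = 0 -> xi = 0.

(** Cayley-Hamilton with the characteristic polynomial split into linear
factors. The product is written as a fold over the eigenvalues so that the
main induction can treat them one at a time. *)
Lemma annihilating_seq (F : closedFieldType) q (A : 'M[F]_q) :
  exists2 s : seq F, size s = q
    & forall xi : 'rV[F]_q, foldl (fun v a => v *m (A - a%:M)) xi s = 0.
Proof.
case: q A => [|q] A; first by exists [::] => // xi; rewrite thinmx0.
have [s char_poly_s] := closed_field_poly_normal (char_poly A).
move: char_poly_s; rewrite (monicP (char_poly_monic A)) scale1r => char_poly_s.
exists s => [|xi].
  by move: (size_char_poly A); rewrite char_poly_s size_prod_XsubC => -[].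
have foldlE v : foldl (fun v a => v *m (A - a%:M)) v s
    = v *m horner_mx A (\prod_(a <- s) ('X - a%:P)).
  elim: s v {char_poly_s} => [|a s IHs] v.
    by rewrite big_nil rmorph1 mulmx1.
  rewrite big_cons /= IHs rmorphM rmorphB /= horner_mx_X horner_mx_C.
  by rewrite mulmxA.
by rewrite foldlE -char_poly_s Cayley_Hamilton mulmx0.
Qed.

Section Annihilators.
Variables (F : fieldType) (q m : nat) (A : 'M[F]_q) (B : 'M[F]_(q, m)).
Variables (x : nat -> 'cV[F]_q) (u : nat -> 'cV[F]_m).
Hypothesis AB_hautus : hautus A B.
Hypothesis x_step : forall t, x t.+1 = A *m x t + B *m u t.

Definition annihilates K N (xi : 'rV[F]_q) (eta : nat -> 'rV[F]_m) :=
  (forall i, (K <= i)%N -> eta i = 0) /\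
  (forall t, (t < N)%N -> xi *m x t + \sum_(i < K) eta i *m u (t + i)%N = 0).

(** The coefficients of the row polynomial xi B + (z - a) eta. *)
Definition shifted a (xi : 'rV[F]_q) (eta : nat -> 'rV[F]_m) i :=
  (if i is j.+1 then eta j else xi *m B) - a *: eta i.

(** Subtract a times the relation at t from the relation at t + 1 and expand
x (t + 1); the relation gets one more input and holds at one instant less. *)
Lemma annihilates_shift a K N xi eta : annihilates K N xi eta ->
  annihilates K.+1 N.-1 (xi *m (A - a%:M)) (shifted a xi eta).
Proof.
move=> [eta_supp ann]; split=> [[//|i] Ki|t tN].
  by rewrite /shifted !eta_supp ?scaler0 ?subr0 // ltnW.
have annS : xi *m x t.+1 + \sum_(i < K) eta i *m u (t.+1 + i)%N = 0.
  by apply: ann; lia.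
have annt : xi *m x t + \sum_(i < K) eta i *m u (t + i)%N = 0.
  by apply: ann; lia.
rewrite /shifted; under eq_bigr do rewrite mulmxBl -scalemxAl.
rewrite sumrB -scaler_sumr [X in _ + (X - _)]big_ord_recl /=.
rewrite [X in _ - _ *: X]big_ord_recr /= eta_supp // mul0mx addr0 addn0.
under [X in _ + (_ + X - _)]eq_bigr do rewrite /bump /= add1n addnS -addSn.
rewrite mulmxBr mulmxBl mul_mx_scalar -scalemxAl.
rewrite addrACA -opprD -scalerDr annt scaler0 subr0.
by rewrite addrA -!mulmxA -mulmxDr -x_step.
Qed.

(** A nonzero eta would make (z - a) eta have positive degree, so that it could
not cancel the constant xi B. Once eta and xi B vanish, xi is a left eigenvector
of A killed by B. *)
Lemma shifted_eq0 a K xi eta : (forall i, (K <= i)%N -> eta i = 0) ->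
  xi *m (A - a%:M) = 0 -> (forall i, shifted a xi eta i = 0) ->
  xi = 0 /\ forall i, eta i = 0.
Proof.
move=> eta_supp xiA shift0.
(* Descending from the top coefficient: eta i = a eta (i + 1). *)
have eta0 k : forall i, (K <= i + k)%N -> eta i = 0.
  elim: k => [|k IHk] i Kik; first by apply: eta_supp; rewrite addn0 in Kik.
  have := shift0 i.+1.
  by rewrite /shifted (IHk i.+1) ?scaler0 ?subr0 // addSnnS.
have {}eta0 i : eta i = 0 by apply: (eta0 K); rewrite leq_addl.
split=> //; apply: (AB_hautus (a := a)).
  by apply/eqP; rewrite -subr_eq0 -mul_mx_scalar -mulmxBr xiA.
by have := shift0 0%N; rewrite /shifted eta0 scaler0 subr0.
Qed.

(** Going through [s], the relation is turned into one between inputs only,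
which excitation makes trivial; [shifted_eq0] then brings triviality back
through the steps. *)
Lemma annihilates_eq0 s K N xi eta :
  exciting u (K + size s) (N - size s) -> annihilates K N xi eta ->
  foldl (fun v a => v *m (A - a%:M)) xi s = 0 ->
  xi = 0 /\ forall i, eta i = 0.
Proof.
elim: s K N xi eta => [|a s IHs] K N xi eta /=.
  rewrite addn0 subn0 => u_exc [eta_supp ann] xi0; split=> //.
  by apply: u_exc => // t tN; have := ann t tN; rewrite xi0 mul0mx add0r.
rewrite addnS -addSn => u_exc ann xi_s.
have [] := IHs K.+1 N.-1 (xi *m (A - a%:M)) (shifted a xi eta) => //.
- by rewrite -subn1 -subnDA add1n.
- exact: (annihilates_shift a ann).
by case: ann => eta_supp _; exact: shifted_eq0 eta_supp.
Qed.

End Annihilators.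

(** * Combinations of time shifts of a signal *)

Section Samples.
Variable F : fieldType.

Definition samples d N (f : nat -> 'cV[F]_d) : 'M[F]_(d, N) :=
  \matrix_(i, j) f j i 0.

Definition combine d N (alpha : 'cV[F]_N) (f : nat -> 'cV[F]_d) t : 'cV[F]_d :=
  \sum_(j < N) alpha j 0 *: f (t + j)%N.

Lemma mulmx_samples e d N (M : 'M[F]_(e, d)) (f : nat -> 'cV[F]_d) :
  M *m samples N f = samples N (fun j => M *m f j).
Proof.
by apply/matrixP => i j; rewrite !mxE; apply: eq_bigr => k _; rewrite !mxE.
Qed.

Lemma samples_mulmx d N (f : nat -> 'cV[F]_d) (alpha : 'cV[F]_N) :
  samples N f *m alpha = combine alpha f 0.
Proof.
apply/matrixP => i j; rewrite !mxE summxE; apply: eq_bigr => k _.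
by rewrite !mxE ord1 mulrC.
Qed.

Lemma samples_eq0P d N (f : nat -> 'cV[F]_d) :
  samples N f = 0 <-> forall t, (t < N)%N -> f t = 0.
Proof.
split=> [f0 t tN|f0]; apply/matrixP => i j.
  by move/matrixP/(_ i (Ordinal tN)): f0; rewrite !mxE ord1.
by rewrite !mxE f0 // mxE.
Qed.

Lemma combine_span d N (f : nat -> 'cV[F]_d) :
  (forall v : 'rV_d, (forall t, (t < N)%N -> v *m f t = 0) -> v = 0) ->
  forall w, exists alpha : 'cV_N, combine alpha f 0 = w.
Proof.
move=> f_sep w; have /row_freeP[M fM] : row_free (samples N f).
  by apply: inj_row_free => v; rewrite mulmx_samples => /samples_eq0P/f_sep.
by exists (M *m w); rewrite -samples_mulmx mulmxA fM mul1mx.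
Qed.

Lemma combineD d N (alpha : 'cV[F]_N) (f g : nat -> 'cV[F]_d) t :
  combine alpha (fun k => f k + g k) t = combine alpha f t + combine alpha g t.
Proof. by rewrite -big_split; apply: eq_bigr => j _; rewrite /= scalerDr. Qed.

Lemma combineM e d N (alpha : 'cV[F]_N) (M : 'M_(e, d))
    (f : nat -> 'cV[F]_d) t :
  combine alpha (fun k => M *m f k) t = M *m combine alpha f t.
Proof.
by rewrite mulmx_sumr; apply: eq_bigr => j _; rewrite /= -scalemxAr.
Qed.

Lemma combine_col_mx d e N (alpha : 'cV[F]_N)
    (f : nat -> 'cV[F]_d) (g : nat -> 'cV[F]_e) t :
  combine alpha (fun k => col_mx (f k) (g k)) t
  = col_mx (combine alpha f t) (combine alpha g t).
Proof.
rewrite /combine; elim/big_rec3: _ => [|j v w z _ ->]; first by rewrite col_mx0.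
by rewrite scale_col_mx add_col_mx.
Qed.

End Samples.

(** * Hankel matrices and the fundamental lemma *)

Section Hankel.
Variable R : realType.

Lemma hankelE L k (f : signal R k) a l :
  hankel L f a l = samples _ (fun j => stack f (a + j) L).
Proof. by []. Qed.

Lemma combine_stack L k (f : signal R k) N (alpha : 'cV_N) :
  combine alpha (fun j => stack f j L) 0 = stack (combine alpha f) 0 L.
Proof.
rewrite /combine /stack mxcol_sum; apply: eq_bigr => h _.
by apply/matrixP => i j; rewrite !mxE !add0n addnC.
Qed.

Lemma eq_stackP L k (f g : signal R k) :
  stack f 0 L = stack g 0 L <-> forall t, (t < L)%N -> f t = g t.
Proof.
split=> [fg t tL|fg].
  have /(_ (Ordinal tL)) // := (eq_mxcolP (p_ := fun=> k)
    (fun i : 'I_L => f (0 + i)%N) (fun i : 'I_L => g (0 + i)%N)).2 fg.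
by rewrite /stack; apply: eq_mxcol => i; rewrite add0n fg.
Qed.

(** A Hankel matrix times alpha is the window of length L of the corresponding
combination of shifts; this reduces the theorem to signals. *)
Lemma hankel_mulmxP L k (f g : signal R k) l (alpha : 'cV_(l.+1 - L)) :
  hankel L f 0 l *m alpha = stack g 0 L <->
  forall t, (t < L)%N -> combine alpha f t = g t.
Proof.
rewrite hankelE samples_mulmx -eq_stackP -combine_stack.
exact: iff_refl.
Qed.

Local Notation toC := (@to_C R _ _).

Lemma to_C_M m n p (M : 'M[R]_(m, n)) (M' : 'M_(n, p)) :
  toC (M *m M') = toC M *m toC M'.
Proof. exact: map_mxM. Qed.

Lemma to_C_eq0 m n (M : 'M[R]_(m, n)) : toC M = 0 -> M = 0.
Proof. by move/eqP; rewrite map_mx_eq0 => /eqP. Qed.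

(** The rank of a real matrix does not change over the complex numbers, where
the eigenvalues of the slow dynamics live. *)
Lemma persistently_exciting_C m (u : signal R m) T K :
  persistently_exciting u T K ->
  exciting (fun t => toC (u t)) K (T.+1 - K).
Proof.
rewrite /persistently_exciting => u_exc eta eta_supp ann.
have u_free : row_free (toC (hankel K u 0 T)).
  by rewrite row_free_map /row_free u_exc sum_nat_const card_ord mulnC.
have : \mxrow_(i < K) eta i *m toC (hankel K u 0 T) = 0.
  have -> : toC (hankel K u 0 T)
      = samples _ (fun j => \mxcol_(i < K) toC (u (j + i)%N)).
    by apply/matrixP => i j; rewrite !mxE add0n.
  rewrite mulmx_samples; apply/samples_eq0P => t tN.
  by rewrite mul_mxrow_mxcol ann.
move/eqP; rewrite mulmx_free_eq0 // => /eqP eta0 i.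
have [/eta_supp //|iK] := leqP K i.
move: (mxrowK (fun i : 'I_K => eta i) (Ordinal iK)) => /= <-.
by rewrite eta0; apply/matrixP => a b; rewrite !mxE.
Qed.

(** The fundamental lemma of Willems: an input exciting enough to compensate for
the q dimensions of the state makes every initial state and every input window
of length K a combination of shifts of the data. *)
Lemma fundamental_lemma q m (A : 'M[R]_q) (B : 'M_(q, m))
    (x : signal R q) (u : signal R m) T K N :
  hautus (toC A) (toC B) -> (forall t, x t.+1 = A *m x t + B *m u t) ->
  persistently_exciting u T (K + q) -> N = (T.+1 - K)%N ->
  forall x0 (w : signal R m), exists alpha : 'cV_N,
    combine alpha x 0 = x0 /\
    forall t, (t < K)%N -> combine alpha u t = w t.
Proof.
move=> AB_hautus x_step u_exc -> x0 w.
have [v sep|alpha] := @combine_span _ _ (T.+1 - K)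
    (fun t => col_mx (x t) (stack u t K)) _ (col_mx x0 (stack w 0 K)).
  (* The linear form v is split into its action xi on the state and the
     coefficients eta of its action on the successive inputs. *)
  pose xi := lsubmx v.
  pose eta i : 'rV_m :=
    if insub i is Some j then submxrow (rsubmx v) (j : 'I_K) else 0.
  have etaE (i : 'I_K) : eta i = submxrow (rsubmx v) i by rewrite /eta valK.
  have [s size_s s_ann] := annihilating_seq (toC A).
  have [] := @annihilates_eq0 _ _ _ (toC A) (toC B) (fun t => toC (x t))
    (fun t => toC (u t)) AB_hautus _ s K (T.+1 - K) (toC xi)
    (fun i => toC (eta i)).
  - by move=> t; rewrite x_step -!to_C_M -map_mxD.
  - by rewrite size_s -subnDA; apply: persistently_exciting_C.
  - split=> [i Ki|t tN].
      by rewrite /eta insubF ?[to_C _]map_mx0 //; apply/negbTE; rewrite -leqNgt.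
    under eq_bigr do rewrite -to_C_M.
    rewrite -to_C_M -[X in _ + X]map_mx_sum -map_mxD.
    suff -> : xi *m x t + \sum_(i < K) eta i *m u (t + i)%N = 0.
      exact: map_mx0.
    rewrite -[RHS](sep t tN) -[in RHS](hsubmxK v) mul_row_col; congr (_ + _).
    rewrite -[rsubmx v]submxrowK mul_mxrow_mxcol.
    by apply: eq_bigr => i _; rewrite etaE.
  - exact: s_ann.
  move=> /to_C_eq0 xi0 eta0; rewrite -[v]hsubmxK -/xi xi0.
  suff -> : rsubmx v = 0 by rewrite row_mx0.
  rewrite -[rsubmx v]submxrowK; apply/mxrowP => i; rewrite mxrowK -etaE.
  by rewrite (to_C_eq0 (eta0 i)); apply/matrixP => a b; rewrite !mxE.
move=> comb; exists alpha.
move: comb; rewrite combine_col_mx combine_stack => /eq_col_mx[-> comb_u].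
by split=> //; apply/eq_stackP.
Qed.

End Hankel.

Lemma eq_hankel (R : realType) L k (f g : signal R k) l :
  (forall t, (t < l)%N -> f t = g t) -> hankel L f 0 l = hankel L g 0 l.
Proof.
move=> fg; apply/matrixP => i j; rewrite !mxE fg //.
have := ltn_ord (tagnat.sig1 i); have := ltn_ord j; lia.
Qed.

(** * Descriptor systems *)

Section Behaviors.
Variables (R : realType) (n m p : nat).
Variables (E A : 'M[R]_n) (B : 'M[R]_(n, m)) (C : 'M[R]_(p, n)).
Variable D : 'M[R]_(p, m).
Local Notation full := (full_behavior E A B C D).

Lemma full_behavior_combine N (alpha : 'cV_N) x u y :
  full (x, u, y) ->
  full (combine alpha x, combine alpha u, combine alpha y).
Proof.
move=> xuy t; rewrite -!combineM -!combineD.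
by split; apply: eq_bigr => j _; rewrite ?addSn; congr (_ *: _);
  have [] := xuy (t + j)%N.
Qed.

Lemma full_behaviorB x u y x' u' y' :
  full (x, u, y) -> full (x', u', y') ->
  full (fun t => x t - x' t, fun t => u t - u' t, fun t => y t - y' t).
Proof.
move=> xuy xuy' t; have [xt yt] := xuy t; have [xt' yt'] := xuy' t.
by rewrite !mulmxBr addrACA -opprD -xt -xt' yt yt' opprD addrACA.
Qed.

End Behaviors.

Section QuasiWeierstrass.
Variables (R : realType) (q r m p : nat).
Variables (E A S P : 'M[R]_(q + r)) (A1 : 'M[R]_q) (N : 'M[R]_r).
Variables (B : 'M[R]_(q + r, m)) (C : 'M[R]_(p, q + r)) (D : 'M[R]_(p, m)).
Hypothesis P_unit : P \in unitmx.
Hypothesis SEP : S *m E *m P = block_mx 1%:M 0 0 N.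
Hypothesis SAP : S *m A *m P = block_mx A1 0 0 1%:M.
Local Notation toC := (@to_C R _ _).

Definition slow_input := usubmx (S *m B).
Definition slow (x : signal R (q + r)) t := usubmx (invmx P *m x t).
Definition fast (x : signal R (q + r)) t := dsubmx (invmx P *m x t).

(** Padding a left eigenvector xi of the slow block with zeros and pulling it
back through S gives a row that annihilates [a E - A, B], since the two blocks
of the quasi-Weierstrass form do not interact. *)
Lemma slow_hautus : S \in unitmx -> R_controllable E A B ->
  hautus (toC A1) (toC slow_input).
Proof.
move=> S_unit AB_ctrl a xi xiA xiB.
have M_free : row_free (row_mx (a *: toC E - toC A) (toC B)).
  by rewrite /row_free AB_ctrl.
have PC_free : row_free (toC P) by rewrite row_free_map row_free_unit.
have SC_free : row_free (toC S) by rewrite row_free_map row_free_unit.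
pose v := row_mx xi (0 : 'rV[R[i]]_r) *m toC S.
have vM : v *m row_mx (a *: toC E - toC A) (toC B) = 0.
  rewrite mul_mx_row; apply/eqP; rewrite row_mx_eq0; apply/andP; split.
    rewrite -(mulmx_free_eq0 _ PC_free) mulmxBr mulmxBl -scalemxAr -scalemxAl.
    rewrite -!mulmxA !(mulmxA (toC S)) -!to_C_M SEP SAP.
    rewrite /to_C !map_block_mx !map_mx0 !map_mx1 !mul_row_block.
    rewrite !mul0mx !mulmx0 !addr0 mulmx1 scale_row_mx scaler0 -/toC.
    by rewrite [xi *m _]xiA subrr.
  rewrite -mulmxA -to_C_M -[S *m B]vsubmxK /to_C map_col_mx mul_row_col.
  by rewrite mul0mx addr0; apply/eqP.
move/eqP: vM; rewrite mulmx_free_eq0 // mulmx_free_eq0 //.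
by rewrite row_mx_eq0 => /andP[/eqP].
Qed.

Lemma slow_fast_step x u y : full_behavior E A B C D (x, u, y) -> forall t,
  slow x t.+1 = A1 *m slow x t + slow_input *m u t
  /\ N *m fast x t.+1 = fast x t + dsubmx (S *m B) *m u t.
Proof.
move=> xuy t; have [/(congr1 (mulmx S)) + _] := xuy t.
rewrite mulmxDr !mulmxA -[x t.+1](mulKVmx P_unit) -[x t](mulKVmx P_unit).
rewrite !(mulmxA _ P) SEP SAP -[invmx P *m x t.+1]vsubmxK.
rewrite -[invmx P *m x t]vsubmxK -[S *m B]vsubmxK !mul_block_col mul_col_mx.
rewrite add_col_mx !mul0mx !mul1mx !addr0 !add0r => /eq_col_mx[].
by rewrite vsubmxK.
Qed.

(** The fast state at t is N^s times the one at t + s as long as the input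
vanishes on [t, t + s - 1]; this window stays inside [0, L + s - 2] for t < L,
so that the fast state vanishes there together with the slow one. *)
Lemma full_behavior_eq0 s L x u y : N ^+ s = 0 -> (0 < s)%N ->
  full_behavior E A B C D (x, u, y) -> slow x 0 = 0 ->
  (forall t, (t < L + s - 1)%N -> u t = 0) ->
  forall t, (t < L)%N -> y t = 0.
Proof.
move=> Ns0 s_gt0 xuy x0 u0 t tL; have [_ ->] := xuy t.
have slow0 k : (k <= L + s - 1)%N -> slow x k = 0.
  elim: k => // k IHk kL; have [-> _] := slow_fast_step xuy k.
  by rewrite IHk ?u0 ?mulmx0 ?addr0 // ltnW.
have fastE k : (k <= s)%N -> fast x t = N ^+ k *m fast x (t + k).
  elim: k => [|k IHk] ks; first by rewrite mul1mx addn0.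
  have [_] := slow_fast_step xuy (t + k).
  rewrite u0 ?mulmx0 ?addr0 => [fast_k|]; last by lia.
  by rewrite IHk 1?ltnW // -fast_k exprSr addnS mulmxA.
have -> : x t = 0.
  rewrite -[x t](mulKVmx P_unit) -[invmx P *m x t]vsubmxK.
  rewrite -/(slow x t) -/(fast x t) slow0 ?(fastE s) ?Ns0 ?mul0mx //; last lia.
  by rewrite col_mx0 mulmx0.
by rewrite u0 ?mulmx0 ?addr0 //; lia.
Qed.

End QuasiWeierstrass.

Theorem lemma5 (R : realType) (n m p : nat)
    (E A : 'M[R]_n) (B : 'M[R]_(n, m)) (C : 'M[R]_(p, n)) (D : 'M[R]_(p, m))
    (q s T L : nat) (ubar : signal R m) (ybar : signal R p)
    (E_A_regular : regular E A)
    (E_A_B_controllable : R_controllable E A B)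
    (q_s_weierstrass : quasi_weierstrass E A q s)
    (T_gt0 : (0 < T)%N) (L_gt0 : (0 < L)%N)
    (T_large : ((m + 1) * (L + q + s) - 1 <= T)%N)
    (data_behavior : restricted_behavior E A B C D 0 (T - 1) (ubar, ybar))
    (ubar_exciting : persistently_exciting ubar T (L + q + s - 1))
    (u : signal R m) (y : signal R p) :
  restricted_behavior E A B C D 0 (L - 1) (u, y) <->
  exists alpha : 'cV[R]_((T - s).+2 - L),
    col_mx (hankel L ubar 0 (T - s).+1) (hankel L ybar 0 (T - s).+1) *m alpha
    = col_mx (stack u 0 L) (stack y 0 L).
Proof.
case: q_s_weierstrass => r [qr_n [S [P [A1 [N [[S_unit P_unit] SEP SAP]]]]]].
case=> s_gt0 Ns0 _.
case: n / qr_n E A B C S P E_A_regular E_A_B_controllable data_behavior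
  S_unit P_unit SEP SAP => E A B C S P _ AB_ctrl data S_unit P_unit.
rewrite !castmx_id => SEP SAP.
(* The trajectory behind the data takes the place of the data, since the
   matrices read it on [0, T - 1] only. *)
have sT : (s <= T)%N by lia.
have [[ub yb] [/= xb xuyb] ubar_b] := data.
have {}ubar_b t : (t < T)%N -> ubar t = ub t /\ ybar t = yb t.
  by move=> tT; apply: ubar_b; lia.
have window k (f g : signal R k) : (forall t, (t < T)%N -> f t = g t) ->
    hankel L f 0 (T - s).+1 = hankel L g 0 (T - s).+1.
  by move=> fg; apply: eq_hankel => t tTs; apply: fg; lia.
rewrite (window _ ubar ub) => [|t /ubar_b[]//].
rewrite (window _ ybar yb) => [|t /ubar_b[]//].
have ub_exciting : persistently_exciting ub T (L + s - 1 + q).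
  rewrite /persistently_exciting -(eq_hankel _ (f := ubar)); last first.
    by move=> t /ubar_b[].
  by have -> : (L + s - 1 + q = L + q + s - 1)%N by lia.
(* The restriction of a trajectory to [0, L - 1] is compared with the
   combination of the data that has the same slow initial state and the same
   inputs up to time L + s - 2. *)
split=> [[[u' y'] [/= x' xuy'] uy']|[alpha]]; last first.
  rewrite mul_col_mx => /eq_col_mx[/hankel_mulmxP comb_u /hankel_mulmxP comb_y].
  exists (combine alpha ub, combine alpha yb).
    by exists (combine alpha xb); apply: full_behavior_combine.
  by move=> t tL; rewrite /= comb_u ?comb_y //; lia.
have {}uy' t : (t < L)%N -> u t = u' t /\ y t = y' t.
  by move=> tL; apply: uy'; lia.
have slow_step t : slow P xb t.+1
    = A1 *m slow P xb t + slow_input S B *m ub t.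
  by have [] := slow_fast_step P_unit SEP SAP xuyb t.
have [|alpha [comb_x comb_u]] := fundamental_lemma (N := (T - s).+2 - L)
  (slow_hautus P_unit SEP SAP S_unit AB_ctrl) slow_step ub_exciting
  _ (slow P x' 0) u'; first by lia.
exists alpha; rewrite mul_col_mx; congr col_mx; apply/hankel_mulmxP => t tL.
  by rewrite comb_u ?(uy' t tL).1 //; lia.
have slow0 : slow P (fun k => combine alpha xb k - x' k) 0 = 0.
  rewrite /slow mulmxBr -combineM linearB linear_sum /= -[X in _ - X]comb_x.
  apply/eqP; rewrite subr_eq0; apply/eqP.
  by apply: eq_bigr => j _; rewrite linearZ.
have diff := full_behaviorB (full_behavior_combine alpha xuyb) xuy'.
rewrite (uy' t tL).2; apply: subr0_eq.
have u0 k : (k < L + s - 1)%N -> combine alpha ub k - u' k = 0.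
  by move=> kL; rewrite comb_u ?subrr.
exact: (full_behavior_eq0 P_unit SEP SAP Ns0 s_gt0 diff slow0 u0 tL).
Qed.
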